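(* Let $\kappa_0\in(0,1)$ be the unique number with $2E(\kappa_0)=K(\kappa_0)$. Then the following two statements hold. (1) Let $l$ be a nonnegative even integer. Then there exists a unique $k_l\in(0,\kappa_0)$ such that $F^+(k_l,l\pi+\frac{\pi}{2})=0$. Moreover, for all $k\in(k_l,1)$ there exist unique $t_1\in(l\pi,l\pi+\frac{\pi}{2})$ and $t_2\in(l\pi+\frac{\pi}{2},(l+1)\pi)$ with $F^+(k,t_i)=0$ for $i=1,2$. (2) Let $l$ be a positive odd integer. Then there exists a unique $k_l\in(0,\kappa_0)$ such that $F^-(k_l,l\pi+\frac{\pi}{2})=0$. Moreover, for all $k\in(k_l,1)$ there exist unique $t_1\in(l\pi,l\pi+\frac{\pi}{2})$ and $t_2\in(l\pi+\frac{\pi}{2},(l+1)\pi)$ with $F^-(k,t_i)=0$ for $i=1,2$. Moreover, every undulary symmetric with respect to the $y$-axis that meets the unit circle orthogonally falls into one of these two cases. That is, if $a>0$, $k\in(0,1)$, $t>0$ and $U^+(a,k)$ meets the unit circle orthogonally at $t$, then there is an even integer $l\ge 0$ such that either $(k,t)=(k_l,l\pi+\frac{\pi}{2})$, or $k\in(k_l,1)$ and $t$ is one of the two numbers $t_1,t_2$ given by (1) for this $l$ and $k$; and if $U^-(a,k)$ meets the unit circle orthogonally at $t$, then there is an odd integer $l\ge1$ such that either $(k,t)=(k_l,l\pi+\frac{\pi}{2})$, or $k\in(k_l,1)$ and $t$ is one of the two numbers $t_1,t_2$ given by (2) for this $l$ and $k$.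
   Context: In formulas with $\pm,\mp$, always take all upper signs or all lower signs. Undularies. For $a>0$ and $k\in(0,1)$ put $b=a\sqrt{1-k^2}$ and $c=\sqrt{a^2-b^2}=ak$. The two undularies symmetric with respect to the $y$-axis with these parameters are the plane curves $U^\pm(a,k)=(g^\pm_{\mathrm u},f^\pm_{\mathrm u})$, $$g^\pm_{\mathrm u}(t)=\int_0^t\sqrt{a^2-c^2\cos^2x}\,dx\mp\frac{c\sin t\,(a\mp c\cos t)}{\sqrt{a^2-c^2\cos^2t}},\qquad f^\pm_{\mathrm u}(t)=\frac{b(a\mp c\cos t)}{\sqrt{a^2-c^2\cos^2t}},\qquad t\in\mathbb R.$$ A curve $(g,f)$ meets (intersects) the unit circle orthogonally at $t>0$ if $g(t)^2+f(t)^2=1$ and $g'(t)f(t)-g(t)f'(t)=0$. For $0<k<1$, $t>0$ let $$I(k,t)=\int_0^t\sqrt{1-k^2\cos^2x}\,dx,\qquad F^\pm(k,t)=k\sin(t)\,I(k,t)\mp(1\mp k\cos t)\sqrt{1-k^2\cos^2t}.$$ Zeros of $F^\pm$ characterize such undularies: for $0<k<1$ and $t>0$ there exists $a>0$ such that $U^\pm(a,k)$ meets the unit circle orthogonally at $t$ if and only if $\pm\sin t>0$ and $F^\pm(k,t)=0$. Complete elliptic integrals: $K(k)=\int_0^{\pi/2}\frac{dx}{\sqrt{1-k^2\sin^2x}}$, $E(k)=\int_0^{\pi/2}\sqrt{1-k^2\sin^2x}\,dx$. There is a unique $\kappa_0\in(0,1)$ with $2E(\kappa_0)=K(\kappa_0)$.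 *)

(* Defs.v *)
(* Classical real numbers of the standard library, with Coquelicot's total
   derivative [Derive] and Riemann integral [RInt]. *)
From Stdlib Require Import Reals.
From Coquelicot Require Import Coquelicot.
Open Scope R_scope.

(* A formula with signs is indexed by the choice of all upper or all lower
   signs: "+-" becomes [+ sgn s] and "-+" becomes [- sgn s]. *)
Inductive sign := upper | lower.

Definition sgn (s : sign) : R :=
  match s with upper => 1 | lower => -1 end.

Definition ellipticK (k : R) : R :=
  RInt (fun x => / sqrt (1 - k ^ 2 * sin x ^ 2)) 0 (PI / 2).

Definition ellipticE (k : R) : R :=
  RInt (fun x => sqrt (1 - k ^ 2 * sin x ^ 2)) 0 (PI / 2).

Definition und_b (a k : R) : R := a * sqrt (1 - k ^ 2).

(* For a > 0 and 0 < k < 1 this is a * k. *)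
Definition und_c (a k : R) : R := sqrt (a ^ 2 - und_b a k ^ 2).

Definition und_g (s : sign) (a k t : R) : R :=
  let c := und_c a k in
  RInt (fun x => sqrt (a ^ 2 - c ^ 2 * cos x ^ 2)) 0 t
  - sgn s * (c * sin t * (a - sgn s * (c * cos t))
             / sqrt (a ^ 2 - c ^ 2 * cos t ^ 2)).

Definition und_f (s : sign) (a k t : R) : R :=
  let b := und_b a k in
  let c := und_c a k in
  b * (a - sgn s * (c * cos t)) / sqrt (a ^ 2 - c ^ 2 * cos t ^ 2).

Definition meets_unit_circle_orthogonally (g f : R -> R) (t : R) : Prop :=
  g t ^ 2 + f t ^ 2 = 1 /\ Derive g t * f t - g t * Derive f t = 0.

Definition undulary_meets_orthogonally (s : sign) (a k t : R) : Prop :=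
  meets_unit_circle_orthogonally (und_g s a k) (und_f s a k) t.

Definition I (k t : R) : R :=
  RInt (fun x => sqrt (1 - k ^ 2 * cos x ^ 2)) 0 t.

Definition F (s : sign) (k t : R) : R :=
  k * sin t * I k t
  - sgn s * ((1 - sgn s * (k * cos t)) * sqrt (1 - k ^ 2 * cos t ^ 2)).

Definition mid (l : nat) : R := INR l * PI + PI / 2.

Definition zero_left (s : sign) (l : nat) (k t : R) : Prop :=
  INR l * PI < t < mid l /\ F s k t = 0.

Definition zero_right (s : sign) (l : nat) (k t : R) : Prop :=
  mid l < t < INR (l + 1) * PI /\ F s k t = 0.

(* Main.v *)
(** Let [s] be the sign [(-1)^l].  On [(l PI, (l+1) PI)] the zeros of [F s k] are
    those of [reducedF s k t = I k t - (1 - s k cos t) w / (s k sin t)], where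
    [w = sqrt (1 - k^2 cos^2 t)].  Its derivative simplifies to
    [(1 - s k cos t) s cos t (1 - k^2) / (k sin^2 t w)], so it increases strictly
    up to the midpoint and decreases strictly past it, and everything is decided
    by its sign at the midpoint, that is by whether [(2l+1) k E(k)] exceeds [1].

    The integrand of [k E(k)] is concave in [k], with derivative the integrand of
    [2 E - K].  Integrating the tangent inequality gives
    [y E(y) <= x E(x) + (2 E(x) - K(x)) (y - x)] for [0 <= x < 1], [0 <= y <= 1].
    As [2 E - K] decreases strictly and vanishes at [kappa0], [k E(k)] increases
    up to [kappa0], and comparison with its value [1] at [k = 1] shows that it
    exceeds [1] for [kappa0 <= k < 1]. *)
Require Import Defs.
From Stdlib Require Import Reals Ranalysis5 Lra Lia.
From Coquelicot Require Import Coquelicot.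
Open Scope R_scope.

(** * Positivity of the radicands and integrability *)

Lemma modulus_lt_1 (k u : R) : 0 <= k < 1 -> 0 <= u ^ 2 <= 1 -> 0 < 1 - k ^ 2 * u ^ 2.
Proof. intros Hk Hu. nra. Qed.

Lemma sin_sq_bounds (x : R) : 0 <= sin x ^ 2 <= 1.
Proof. generalize (SIN_bound x); nra. Qed.

Lemma cos_sq_bounds (x : R) : 0 <= cos x ^ 2 <= 1.
Proof. generalize (COS_bound x); nra. Qed.

Lemma radicand_sin_pos (k x : R) : 0 <= k < 1 -> 0 < 1 - k ^ 2 * sin x ^ 2.
Proof. intros Hk. apply modulus_lt_1; [assumption | apply sin_sq_bounds]. Qed.

Lemma radicand_cos_pos (k x : R) : 0 <= k < 1 -> 0 < 1 - k ^ 2 * cos x ^ 2.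
Proof. intros Hk. apply modulus_lt_1; [assumption | apply cos_sq_bounds]. Qed.

Lemma continuous_sqrt_sin (k x : R) :
  continuous (fun x => sqrt (1 - k ^ 2 * sin x ^ 2)) x.
Proof.
  apply (continuous_comp (fun x => 1 - k ^ 2 * sin x ^ 2) sqrt).
  - apply (@ex_derive_continuous R_AbsRing R_NormedModule). auto_derive. exact Logic.I.
  - apply continuous_sqrt.
Qed.

Lemma continuous_sqrt_cos (k x : R) :
  continuous (fun x => sqrt (1 - k ^ 2 * cos x ^ 2)) x.
Proof.
  apply (continuous_comp (fun x => 1 - k ^ 2 * cos x ^ 2) sqrt).
  - apply (@ex_derive_continuous R_AbsRing R_NormedModule). auto_derive. exact Logic.I.
  - apply continuous_sqrt.
Qed.

Lemma continuous_inv_sqrt_sin (k x : R) :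
  0 <= k < 1 -> continuous (fun x => / sqrt (1 - k ^ 2 * sin x ^ 2)) x.
Proof.
  intros Hk. pose proof (radicand_sin_pos k x Hk) as Hp.
  apply (@ex_derive_continuous R_AbsRing R_NormedModule). auto_derive.
  split; [ exact Hp | split; [ | exact Logic.I ] ].
  apply Rgt_not_eq, sqrt_lt_R0, Hp.
Qed.

Lemma ex_RInt_sqrt_sin (k a b : R) :
  ex_RInt (fun x => sqrt (1 - k ^ 2 * sin x ^ 2)) a b.
Proof. apply (@ex_RInt_continuous R_CompleteNormedModule). intros; apply continuous_sqrt_sin. Qed.

Lemma ex_RInt_sqrt_cos (k a b : R) :
  ex_RInt (fun x => sqrt (1 - k ^ 2 * cos x ^ 2)) a b.
Proof. apply (@ex_RInt_continuous R_CompleteNormedModule). intros; apply continuous_sqrt_cos. Qed.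

Lemma ex_RInt_inv_sqrt_sin (k a b : R) :
  0 <= k < 1 -> ex_RInt (fun x => / sqrt (1 - k ^ 2 * sin x ^ 2)) a b.
Proof.
  intros Hk. apply (@ex_RInt_continuous R_CompleteNormedModule).
  intros; apply continuous_inv_sqrt_sin, Hk.
Qed.

(** * The function [k E(k)] *)

Lemma tangent_inequality (x y u : R) :
  0 <= x < 1 -> 0 <= y <= 1 -> 0 <= u <= 1 ->
  y * sqrt (1 - y ^ 2 * u) <=
  x * sqrt (1 - x ^ 2 * u)
  + (2 * sqrt (1 - x ^ 2 * u) - / sqrt (1 - x ^ 2 * u)) * (y - x).
Proof.
  intros Hx Hy Hu.
  assert (Px : 0 < 1 - x ^ 2 * u) by nra.
  assert (Py : 0 <= 1 - y ^ 2 * u) by nra.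
  pose proof (sqrt_lt_R0 _ Px) as Hw. pose proof (sqrt_pos (1 - y ^ 2 * u)) as Hv.
  pose proof (sqrt_sqrt _ (Rlt_le _ _ Px)) as Ew. pose proof (sqrt_sqrt _ Py) as Ev.
  set (w := sqrt (1 - x ^ 2 * u)) in *. set (v := sqrt (1 - y ^ 2 * u)) in *.
  apply Rmult_le_reg_r with w; [exact Hw |].
  replace ((x * w + (2 * w - / w) * (y - x)) * w)
    with ((w * w) * (2 * y - x) - (y - x)) by (field; lra).
  rewrite Ew.
  (* AM-GM for [v * w] leaves the remainder [u (x - y)^2 (2 x + y) / 2]. *)
  assert (AM : v * w <= 1 - (x ^ 2 + y ^ 2) * u / 2) by (generalize (Rle_0_sqr (v - w)); unfold Rsqr; nra).
  assert (D : 0 <= u * ((x - y) ^ 2 * (2 * x + y))).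
  { apply Rmult_le_pos; [lra | apply Rmult_le_pos; [apply pow2_ge_0 | lra]]. }
  assert (AMy : y * (v * w) <= y * (1 - (x ^ 2 + y ^ 2) * u / 2))
    by (apply Rmult_le_compat_l; lra).
  nra.
Qed.

Lemma kE_tangent (x y : R) :
  0 <= x < 1 -> 0 <= y <= 1 ->
  y * ellipticE y <= x * ellipticE x + (2 * ellipticE x - ellipticK x) * (y - x).
Proof.
  intros Hx Hy. unfold ellipticE, ellipticK.
  pose proof (ex_RInt_sqrt_sin x 0 (PI / 2)) as Ex.
  pose proof (ex_RInt_sqrt_sin y 0 (PI / 2)) as Ey.
  pose proof (ex_RInt_inv_sqrt_sin x 0 (PI / 2) Hx) as Kx.
  (* The tangent line is regrouped as [(2 * y - x) * w + (x - y) / w], a combination of the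
     integrands of [ellipticE] and [ellipticK]. *)
  assert (HR : is_RInt (fun t => plus (scal (2 * y - x) (sqrt (1 - x ^ 2 * sin t ^ 2)))
                           (scal (x - y) (/ sqrt (1 - x ^ 2 * sin t ^ 2)))) 0 (PI / 2)
             (plus (scal (2 * y - x) (RInt (fun t => sqrt (1 - x ^ 2 * sin t ^ 2)) 0 (PI / 2)))
                (scal (x - y) (RInt (fun t => / sqrt (1 - x ^ 2 * sin t ^ 2)) 0 (PI / 2))))).
  { apply @is_RInt_plus; apply @is_RInt_scal; apply @RInt_correct; assumption. }
  assert (HL : is_RInt (fun t => scal y (sqrt (1 - y ^ 2 * sin t ^ 2))) 0 (PI / 2)
             (scal y (RInt (fun t => sqrt (1 - y ^ 2 * sin t ^ 2)) 0 (PI / 2)))).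
  { apply @is_RInt_scal; apply @RInt_correct; assumption. }
  assert (HI := is_RInt_le _ _ 0 (PI / 2) _ _ ltac:(generalize PI_RGT_0; lra) HL HR).
  unfold plus, scal in HI; simpl in HI; unfold mult in HI; simpl in HI.
  match type of HI with ?A -> _ => assert (HA : A) end.
  { intros t _. pose proof (tangent_inequality x y (sin t ^ 2) Hx Hy (sin_sq_bounds t)) as T.
    simpl in T. lra. }
  specialize (HI HA). simpl. lra.
Qed.

Lemma ellipticE_1 : ellipticE 1 = 1.
Proof.
  unfold ellipticE. rewrite (RInt_ext _ cos).
  - apply is_RInt_unique.
    replace 1 with (minus (sin (PI / 2)) (sin 0))
      by (rewrite sin_PI2, sin_0; unfold minus, plus, opp; simpl; ring).
    apply (@is_RInt_derive R_CompleteNormedModule sin cos).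
    + intros x _. auto_derive; [exact Logic.I | ring].
    + intros x _. apply continuity_pt_filterlim, continuity_cos.
  - pose proof PI_RGT_0. intros x Hx.
    rewrite Rmin_left, Rmax_right in Hx by lra.
    replace (1 - 1 ^ 2 * sin x ^ 2) with (Rsqr (cos x))
      by (generalize (sin2_cos2 x); unfold Rsqr; nra).
    apply sqrt_Rsqr, cos_ge_0; lra.
Qed.

Lemma ellipticE_decr (x y : R) : 0 <= x < y -> y < 1 -> ellipticE y < ellipticE x.
Proof.
  intros Hx Hy. pose proof PI_RGT_0. unfold ellipticE.
  apply RInt_lt; [lra | intros; apply continuous_sqrt_sin
                      | intros; apply continuous_sqrt_sin |].
  intros t Ht. pose proof (radicand_sin_pos y t ltac:(lra)).
  apply sqrt_lt_1_alt. split; [lra |].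
  assert (0 < sin t) by (apply sin_gt_0; lra).
  assert (0 < sin t ^ 2) by nra.
  assert (x ^ 2 < y ^ 2) by nra. nra.
Qed.

Lemma ellipticK_incr (x y : R) : 0 <= x < y -> y < 1 -> ellipticK x < ellipticK y.
Proof.
  intros Hx Hy. pose proof PI_RGT_0. unfold ellipticK.
  apply RInt_lt; [lra | intros; apply continuous_inv_sqrt_sin; lra
                      | intros; apply continuous_inv_sqrt_sin; lra |].
  intros t Ht.
  pose proof (radicand_sin_pos y t ltac:(lra)).
  pose proof (radicand_sin_pos x t ltac:(lra)).
  apply Rinv_lt_contravar.
  - apply Rmult_lt_0_compat; apply sqrt_lt_R0; assumption.
  - apply sqrt_lt_1_alt. split; [lra |].
    assert (0 < sin t) by (apply sin_gt_0; lra).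
    assert (0 < sin t ^ 2) by nra.
  assert (x ^ 2 < y ^ 2) by nra. nra.
Qed.

Lemma ellipticE_upper (k : R) : ellipticE k <= PI / 2.
Proof.
  pose proof PI_RGT_0. unfold ellipticE.
  replace (PI / 2) with (RInt (fun _ => 1) 0 (PI / 2)) at 2.
  - apply RInt_le; [lra | apply ex_RInt_sqrt_sin | apply ex_RInt_const |].
    intros x _. apply Rle_trans with (sqrt 1); [ | rewrite sqrt_1; lra ]. apply sqrt_le_1_alt.
    pose proof (Rmult_le_pos _ _ (pow2_ge_0 k) (pow2_ge_0 (sin x))). lra.
  - rewrite RInt_const. unfold scal; simpl; unfold mult; simpl. ring.
Qed.

Lemma ellipticK_nonneg (k : R) : 0 <= k < 1 -> 0 <= ellipticK k.
Proof.
  intros Hk. pose proof PI_RGT_0. unfold ellipticK.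
  apply RInt_ge_0; [lra | apply ex_RInt_inv_sqrt_sin, Hk |].
  intros x _. apply Rlt_le, Rinv_0_lt_compat, sqrt_lt_R0, radicand_sin_pos, Hk.
Qed.

Lemma twoE_minus_K_pos (kappa0 k : R) :
  0 < kappa0 < 1 -> 2 * ellipticE kappa0 = ellipticK kappa0 ->
  0 <= k < kappa0 -> 0 < 2 * ellipticE k - ellipticK k.
Proof.
  intros H0 HEK Hk.
  pose proof (ellipticE_decr k kappa0 ltac:(lra) ltac:(lra)).
  pose proof (ellipticK_incr k kappa0 ltac:(lra) ltac:(lra)). lra.
Qed.

(** The tangent is taken at the larger point [y]: its slope there is positive, so at [x] it already
    lies strictly below [y * ellipticE y]. *)
Lemma kE_incr (kappa0 x y : R) :
  0 < kappa0 < 1 -> 2 * ellipticE kappa0 = ellipticK kappa0 ->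
  0 <= x < y -> y < kappa0 -> x * ellipticE x < y * ellipticE y.
Proof.
  intros H0 HEK Hx Hy.
  pose proof (twoE_minus_K_pos kappa0 y H0 HEK ltac:(lra)) as P.
  pose proof (kE_tangent y x ltac:(lra) ltac:(lra)). nra.
Qed.

(** Past [kappa0] the slope is negative, so the tangent at [k] descends strictly on the way to 1,
    where it is still at least [ellipticE 1 = 1]. *)
Lemma kE_gt_1_above (kappa0 k : R) :
  0 < kappa0 < 1 -> 2 * ellipticE kappa0 = ellipticK kappa0 ->
  kappa0 < k < 1 -> 1 < k * ellipticE k.
Proof.
  intros H0 HEK Hk.
  pose proof (ellipticE_decr kappa0 k ltac:(lra) ltac:(lra)).
  pose proof (ellipticK_incr kappa0 k ltac:(lra) ltac:(lra)).
  pose proof (kE_tangent k 1 ltac:(lra) ltac:(lra)) as T.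
  rewrite ellipticE_1 in T. nra.
Qed.

Lemma kE_gt_1 (kappa0 k : R) :
  0 < kappa0 < 1 -> 2 * ellipticE kappa0 = ellipticK kappa0 ->
  kappa0 <= k < 1 -> 1 < k * ellipticE k.
Proof.
  intros H0 HEK Hk. destruct (Req_dec k kappa0) as [-> | Hne].
  (* The tangent at [kappa0] is horizontal, so the value there is at least the value at any point of
     [(kappa0, 1)]; the midpoint is one such point. *)
  - pose proof (kE_gt_1_above kappa0 ((kappa0 + 1) / 2) H0 HEK ltac:(lra)).
    pose proof (kE_tangent kappa0 ((kappa0 + 1) / 2) ltac:(lra) ltac:(lra)). nra.
  - apply (kE_gt_1_above kappa0); [assumption | assumption | lra].
Qed.

(** Provides continuity for the intermediate value theorem without differentiating under the
    integral. For two points up to [kappa0], the tangent at the smaller one bounds the increment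
    above and the tangent at the larger one bounds it below; both slopes lie in [[0, PI]]. *)
Lemma kE_lipschitz (kappa0 x y : R) :
  0 < kappa0 < 1 -> 2 * ellipticE kappa0 = ellipticK kappa0 ->
  0 <= x <= kappa0 -> 0 <= y <= kappa0 ->
  Rabs (y * ellipticE y - x * ellipticE x) <= PI * Rabs (y - x).
Proof.
  intros H0 HEK.
  assert (S : forall x, 0 <= x <= kappa0 -> 0 <= 2 * ellipticE x - ellipticK x <= PI).
  { intros z Hz. pose proof (ellipticE_upper z). pose proof (ellipticK_nonneg z ltac:(lra)).
    destruct (Req_dec z kappa0) as [-> | Hne]; [lra |].
    pose proof (twoE_minus_K_pos kappa0 z H0 HEK ltac:(lra)). lra. }
  assert (L : forall x y, 0 <= x <= kappa0 -> 0 <= y <= kappa0 -> x <= y ->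
            Rabs (y * ellipticE y - x * ellipticE x) <= PI * Rabs (y - x)).
  { intros u v Hu Hv Huv.
    pose proof (S u Hu). pose proof (S v Hv).
    pose proof (kE_tangent u v ltac:(lra) ltac:(lra)).
    pose proof (kE_tangent v u ltac:(lra) ltac:(lra)).
    rewrite !Rabs_pos_eq; nra. }
  intros Hx Hy. destruct (Rle_dec x y) as [H | H].
  - apply L; assumption.
  - rewrite (Rabs_minus_sym (_ * _)), (Rabs_minus_sym y). apply L; lra.
Qed.

(* [IVT_interv] asks for two-sided continuity at the ends of the interval. *)
Definition clamp (b x : R) : R := Rmax 0 (Rmin x b).

Lemma clamp_bounds (b x : R) : 0 <= b -> 0 <= clamp b x <= b.
Proof.
  intros Hb. unfold clamp, Rmax, Rmin.
  destruct (Rle_dec x b); destruct (Rle_dec 0 _); lra.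
Qed.

Lemma clamp_id (b x : R) : 0 <= x <= b -> clamp b x = x.
Proof. intros Hx. unfold clamp. rewrite Rmin_left, Rmax_right; lra. Qed.

Lemma clamp_contraction (b x y : R) : 0 <= b -> Rabs (clamp b y - clamp b x) <= Rabs (y - x).
Proof.
  intros Hb. unfold clamp, Rmax, Rmin.
  destruct (Rle_dec x b); destruct (Rle_dec y b);
  repeat (match goal with |- context [Rle_dec 0 ?u] => destruct (Rle_dec 0 u) end);
  unfold Rabs;
  repeat (match goal with |- context [Rcase_abs ?u] => destruct (Rcase_abs u) end); lra.
Qed.

(** The level [/ c] lies in [(0, 1]], strictly between the value 0 at modulus 0 and the value above
    1 at [kappa0]. The result is a sigma type so that the threshold moduli can be defined as a
    function of [l] by projection. *)
Lemma kE_level_exists (kappa0 c : R) :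
  0 < kappa0 < 1 -> 2 * ellipticE kappa0 = ellipticK kappa0 ->
  1 <= c -> {k : R | 0 < k < kappa0 /\ c * (k * ellipticE k) = 1}.
Proof.
  intros H0 HEK Hc. pose proof PI_RGT_0.
  pose proof (kE_gt_1 kappa0 kappa0 H0 HEK ltac:(lra)) as Hend.
  set (m := fun k => clamp kappa0 k * ellipticE (clamp kappa0 k)).
  destruct (IVT_interv (fun k => m k - / c) 0 kappa0) as [k [Hk Ek]].
  - intros x _ eps Heps. exists (eps / PI). split; [apply Rdiv_lt_0_compat; lra |].
    intros y [_ Hy]. simpl in *. unfold Rdist in *.
    replace (m y - / c - (m x - / c)) with (m y - m x) by ring.
    apply Rle_lt_trans with (PI * Rabs (clamp kappa0 y - clamp kappa0 x)).
    + apply (kE_lipschitz kappa0); try assumption; apply clamp_bounds; lra.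
    + apply Rle_lt_trans with (PI * Rabs (y - x)).
      * apply Rmult_le_compat_l; [lra | apply clamp_contraction; lra].
      * replace eps with (PI * (eps / PI)) by (field; lra).
        apply Rmult_lt_compat_l; lra.
  - lra.
  - unfold m. rewrite clamp_id by lra. pose proof (Rinv_0_lt_compat c). lra.
  - unfold m. rewrite clamp_id by lra.
    assert (/ c <= 1) by (rewrite <- Rinv_1; apply Rinv_le_contravar; lra). lra.
  - unfold m in Ek. rewrite clamp_id in Ek by lra.
    assert (E : k * ellipticE k = / c) by lra.
    assert (Hinv : 0 < / c) by (apply Rinv_0_lt_compat; lra).
    exists k. split; [| rewrite E; field; lra].
    assert (/ c <= 1) by (rewrite <- Rinv_1; apply Rinv_le_contravar; lra).
    split.
    + destruct (Req_dec k 0) as [-> | ]; lra.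
    + destruct (Req_dec k kappa0) as [-> | ]; lra.
Qed.

(** * The value at the midpoint *)

Lemma sin_nat_PI_plus (l : nat) (x : R) : sin (INR l * PI + x) = (-1) ^ l * sin x.
Proof.
  induction l as [| l IH]; [simpl; rewrite Rmult_0_l, Rplus_0_l; ring |].
  rewrite S_INR. replace ((INR l + 1) * PI + x) with ((INR l * PI + x) + PI) by ring.
  rewrite neg_sin, IH. simpl. ring.
Qed.

Lemma cos_nat_PI_plus (l : nat) (x : R) : cos (INR l * PI + x) = (-1) ^ l * cos x.
Proof.
  induction l as [| l IH]; [simpl; rewrite Rmult_0_l, Rplus_0_l; ring |].
  rewrite S_INR. replace ((INR l + 1) * PI + x) with ((INR l * PI + x) + PI) by ring.
  rewrite neg_cos, IH. simpl. ring.
Qed.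

Lemma RInt_reflect (f : R -> R) (a b c : R) :
  ex_RInt f (c - b) (c - a) ->
  RInt (fun x => f (c - x)) a b = RInt f (c - b) (c - a).
Proof.
  intros Hf. apply ex_RInt_swap in Hf.
  rewrite <- (opp_RInt_swap f (c - a) (c - b)) by exact Hf.
  assert (E := RInt_comp_lin f (-1) c a b).
  replace (-1 * a + c) with (c - a) in E by ring.
  replace (-1 * b + c) with (c - b) in E by ring.
  rewrite <- (E Hf), <- RInt_opp.
  - apply RInt_ext. intros x _. unfold opp, scal; simpl; unfold mult; simpl.
    replace (-1 * x + c) with (c - x) by ring. ring.
  - apply (@ex_RInt_comp_lin R_NormedModule).
    replace (-1 * a + c) with (c - a) by ring.
    replace (-1 * b + c) with (c - b) by ring. exact Hf.
Qed.

Lemma I_half_pi (k : R) : I k (PI / 2) = ellipticE k.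
Proof.
  unfold I, ellipticE.
  rewrite (RInt_ext _ (fun x => sqrt (1 - k ^ 2 * sin (PI / 2 - x) ^ 2))).
  - rewrite (RInt_reflect (fun x => sqrt (1 - k ^ 2 * sin x ^ 2)) 0 (PI / 2) (PI / 2))
      by apply ex_RInt_sqrt_sin.
    f_equal; ring.
  - intros x _. now rewrite sin_shift.
Qed.

Lemma RInt_sqrt_sin_pi (k : R) :
  RInt (fun x => sqrt (1 - k ^ 2 * sin x ^ 2)) 0 PI = 2 * ellipticE k.
Proof.
  rewrite <- (RInt_Chasles _ 0 (PI / 2) PI) by apply ex_RInt_sqrt_sin.
  rewrite (RInt_ext _ (fun x => sqrt (1 - k ^ 2 * sin (PI - x) ^ 2)) (PI / 2) PI).
  - rewrite (RInt_reflect (fun x => sqrt (1 - k ^ 2 * sin x ^ 2)) (PI / 2) PI PI)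
      by apply ex_RInt_sqrt_sin.
    replace (PI - PI) with 0 by ring. replace (PI - PI / 2) with (PI / 2) by field.
    unfold ellipticE, plus; simpl. ring.
  - intros x _. now rewrite sin_PI_x.
Qed.

(** The integrand has period [PI]: the stretch up to [PI / 2] contributes one [ellipticE k], and
    each passage from one midpoint to the next contributes a full period, that is two more. *)
Lemma I_mid (k : R) (l : nat) : I k (mid l) = (2 * INR l + 1) * ellipticE k.
Proof.
  induction l as [| l IH].
  - unfold mid. simpl INR. rewrite Rmult_0_l, Rplus_0_l, I_half_pi. ring.
  - unfold I in *.
    rewrite <- (RInt_Chasles _ 0 (mid l) (mid (S l))) by apply ex_RInt_sqrt_cos.
    rewrite IH.
    assert (P : RInt (fun x => sqrt (1 - k ^ 2 * cos x ^ 2)) (mid l) (mid (S l))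
                = 2 * ellipticE k).
    { rewrite <- RInt_sqrt_sin_pi.
      assert (E := RInt_comp_lin (fun x => sqrt (1 - k ^ 2 * cos x ^ 2)) 1 (mid l) 0 PI).
      replace (1 * 0 + mid l) with (mid l) in E by ring.
      replace (1 * PI + mid l) with (mid (S l)) in E
        by (unfold mid; rewrite S_INR; ring).
      rewrite <- E by apply ex_RInt_sqrt_cos.
      apply RInt_ext. intros x _. unfold scal; simpl; unfold mult; simpl.
      rewrite Rmult_1_l. f_equal.
      (* Shifting by [mid l] turns the cosine into a sine up to sign, and the sign disappears in the
         square. *)
      replace (1 * x + mid l) with (INR l * PI + (PI / 2 + x)) by (unfold mid; ring).
      rewrite cos_nat_PI_plus. replace (PI / 2 + x) with (x + PI / 2) by ring.
      rewrite cos_plus, cos_PI2, sin_PI2.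
      assert (Q : (-1) ^ l * (-1) ^ l = 1)
        by (rewrite <- Rpow_mult_distr; replace (-1 * -1) with 1 by ring; apply pow1).
      replace ((-1) ^ l * (cos x * 0 - sin x * 1) *
        ((-1) ^ l * (cos x * 0 - sin x * 1) * 1))
        with (((-1) ^ l * (-1) ^ l) * (sin x * sin x)) by ring.
      rewrite Q. ring. }
    rewrite P, S_INR. unfold plus; simpl. ring.
Qed.

(** * Monotonicity of the normalized function *)

Definition reducedF (s : Defs.sign) (k t : R) : R :=
  I k t
  - (1 - sgn s * (k * cos t)) * sqrt (1 - k ^ 2 * cos t ^ 2) / (k * (sgn s * sin t)).

(** Ties the sign to the interval so that [sgn s * sin t] is positive throughout it; even and odd
    [l] are then treated by the same argument. *)
Definition parity (s : Defs.sign) (l : nat) : Prop := sgn s = (-1) ^ l.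

Lemma sgn_sq (s : Defs.sign) : sgn s * sgn s = 1.
Proof. destruct s; simpl; ring. Qed.

Lemma F_eq_reducedF (s : Defs.sign) (k t : R) :
  0 < k -> sin t <> 0 -> F s k t = k * sin t * reducedF s k t.
Proof.
  intros Hk Ht. unfold F, reducedF. destruct s; simpl; field; split; lra.
Qed.

Lemma is_derive_I (k t : R) : is_derive (I k) t (sqrt (1 - k ^ 2 * cos t ^ 2)).
Proof.
  unfold I. apply (is_derive_RInt (fun x => sqrt (1 - k ^ 2 * cos x ^ 2)) _ 0 t).
  - apply filter_forall. intros y. apply @RInt_correct, ex_RInt_sqrt_cos.
  - apply continuous_sqrt_cos.
Qed.

Lemma is_derive_reducedF (s : Defs.sign) (k t : R) :
  0 < k < 1 -> sin t <> 0 ->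
  is_derive (reducedF s k) t
    ((1 - sgn s * (k * cos t)) * (sgn s * cos t) * (1 - k ^ 2)
     / (k * sin t ^ 2 * sqrt (1 - k ^ 2 * cos t ^ 2))).
Proof.
  intros Hk Ht. pose proof (radicand_cos_pos k t ltac:(lra)) as Hp.
  pose proof (sqrt_lt_R0 _ Hp) as Hw.
  pose proof (sqrt_sqrt _ (Rlt_le _ _ Hp)) as Ew.
  pose proof (sin2_cos2 t) as SC. unfold Rsqr in SC.
  (* The derivative of the quotient is stated with the root split off, ready to cancel against the
     derivative of [I k]. *)
  assert (D : is_derive (fun t => (1 - sgn s * (k * cos t)) * sqrt (1 - k ^ 2 * cos t ^ 2)
                                  / (k * (sgn s * sin t))) t
     (sqrt (1 - k ^ 2 * cos t ^ 2)
      - (1 - sgn s * (k * cos t)) * (sgn s * cos t) * (1 - k ^ 2)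
        / (k * sin t ^ 2 * sqrt (1 - k ^ 2 * cos t ^ 2)))).
  { auto_derive.
    - repeat split; [exact Hp |].
      destruct s; simpl; apply Rmult_integral_contrapositive_currified; lra.
    - replace (1 + - (k * (k * 1) * (cos t * (cos t * 1)))) with (1 - k ^ 2 * cos t ^ 2) by ring.
      set (w := sqrt (1 - k ^ 2 * cos t ^ 2)) in *.
      set (S := sin t) in *. set (C := cos t) in *.
      assert (ES : S * S = 1 - C * C) by lra.
      (* With root, sine and cosine opaque, the claim is a rational identity modulo [Ew] and
         [ES]. *)
      clearbody w S C. destruct s; simpl sgn.
      + field [Ew ES]; lra.
      + field [Ew ES]; lra. }
  unfold reducedF.
  replace ((1 - sgn s * (k * cos t)) * (sgn s * cos t) * (1 - k ^ 2)
     / (k * sin t ^ 2 * sqrt (1 - k ^ 2 * cos t ^ 2)))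
  with (minus (sqrt (1 - k ^ 2 * cos t ^ 2)) (sqrt (1 - k ^ 2 * cos t ^ 2)
      - (1 - sgn s * (k * cos t)) * (sgn s * cos t) * (1 - k ^ 2)
        / (k * sin t ^ 2 * sqrt (1 - k ^ 2 * cos t ^ 2))))
  by (unfold minus, plus, opp; simpl; ring).
  apply (is_derive_minus (I k)); [apply is_derive_I | exact D].
Qed.

Lemma sgn_cos_factor_pos (s : Defs.sign) (k t : R) : 0 < k < 1 -> 0 < 1 - sgn s * (k * cos t).
Proof. intros Hk. pose proof (COS_bound t). destruct s; simpl; nra. Qed.

Lemma sgn_sin_pos (s : Defs.sign) (l : nat) (t : R) :
  parity s l -> INR l * PI < t < INR (l + 1) * PI -> 0 < sgn s * sin t.
Proof.
  intros Hp Ht. rewrite plus_INR in Ht. simpl (INR 1) in Ht.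
  replace t with (INR l * PI + (t - INR l * PI)) by ring.
  rewrite sin_nat_PI_plus, <- Hp, <- Rmult_assoc, sgn_sq, Rmult_1_l.
  apply sin_gt_0; lra.
Qed.

Lemma sgn_cos_pos (s : Defs.sign) (l : nat) (t : R) :
  parity s l -> INR l * PI < t < mid l -> 0 < sgn s * cos t.
Proof.
  unfold mid. intros Hp Ht. pose proof PI_RGT_0.
  replace t with (INR l * PI + (t - INR l * PI)) by ring.
  rewrite cos_nat_PI_plus, <- Hp, <- Rmult_assoc, sgn_sq, Rmult_1_l.
  apply cos_gt_0; lra.
Qed.

Lemma sgn_cos_neg (s : Defs.sign) (l : nat) (t : R) :
  parity s l -> mid l < t < INR (l + 1) * PI -> sgn s * cos t < 0.
Proof.
  unfold mid. rewrite plus_INR. simpl (INR 1). intros Hp Ht. pose proof PI_RGT_0.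
  replace t with (INR l * PI + (t - INR l * PI)) by ring.
  rewrite cos_nat_PI_plus, <- Hp, <- Rmult_assoc, sgn_sq, Rmult_1_l.
  apply cos_lt_0; lra.
Qed.

Lemma mid_bounds (l : nat) : INR l * PI < mid l < INR (l + 1) * PI.
Proof. unfold mid. rewrite plus_INR. simpl (INR 1). pose proof PI_RGT_0. lra. Qed.

(** Every factor of the derivative other than [sgn s * cos c] is positive; together with [y - x]
    they are absorbed into [p], so that monotonicity is read off from the sign of the cosine
    alone. *)
Lemma reducedF_MVT (s : Defs.sign) (l : nat) (k x y : R) :
  0 < k < 1 -> parity s l -> INR l * PI < x -> x < y -> y < INR (l + 1) * PI ->
  exists c p, x < c < y /\ 0 < p /\
    reducedF s k y - reducedF s k x = (sgn s * cos c) * p.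
Proof.
  intros Hk Hp Hx Hxy Hy.
  assert (N : forall c, x <= c <= y -> sin c <> 0).
  { intros c Hc E. pose proof (sgn_sin_pos s l c Hp ltac:(lra)). rewrite E in *. lra. }
  destruct (MVT_cor2 (reducedF s k) (fun t =>
    (1 - sgn s * (k * cos t)) * (sgn s * cos t) * (1 - k ^ 2)
     / (k * sin t ^ 2 * sqrt (1 - k ^ 2 * cos t ^ 2))) x y Hxy) as [c [E Hc]].
  - intros c Hc. apply is_derive_Reals, is_derive_reducedF; [exact Hk | apply N, Hc].
  - pose proof (N c ltac:(lra)).
    pose proof (sqrt_lt_R0 _ (radicand_cos_pos k c ltac:(lra))) as Hw.
    pose proof (sgn_cos_factor_pos s k c Hk).
    exists c, ((1 - sgn s * (k * cos c)) * (1 - k ^ 2)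
     / (k * sin c ^ 2 * sqrt (1 - k ^ 2 * cos c ^ 2)) * (y - x)).
    split; [exact Hc |]. split.
    + apply Rmult_lt_0_compat; [| lra]. apply Rdiv_lt_0_compat.
      * apply Rmult_lt_0_compat; nra.
      * apply Rmult_lt_0_compat; [apply Rmult_lt_0_compat |]; [lra | | exact Hw].
        apply pow2_gt_0; assumption.
    + rewrite E. field. repeat split; lra.
Qed.

Lemma reducedF_incr (s : Defs.sign) (l : nat) (k x y : R) :
  0 < k < 1 -> parity s l -> INR l * PI < x -> x < y -> y <= mid l ->
  reducedF s k x < reducedF s k y.
Proof.
  intros Hk Hp Hx Hxy Hy. pose proof (mid_bounds l).
  destruct (reducedF_MVT s l k x y Hk Hp Hx Hxy ltac:(lra)) as [c [p [Hc [Hpos E]]]].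
  pose proof (sgn_cos_pos s l c Hp ltac:(lra)). nra.
Qed.

Lemma reducedF_decr (s : Defs.sign) (l : nat) (k x y : R) :
  0 < k < 1 -> parity s l -> mid l <= x -> x < y -> y < INR (l + 1) * PI ->
  reducedF s k y < reducedF s k x.
Proof.
  intros Hk Hp Hx Hxy Hy. pose proof (mid_bounds l).
  destruct (reducedF_MVT s l k x y Hk Hp ltac:(lra) Hxy Hy) as [c [p [Hc [Hpos E]]]].
  pose proof (sgn_cos_neg s l c Hp ltac:(lra)). nra.
Qed.

Lemma F_zero_iff (s : Defs.sign) (l : nat) (k t : R) :
  0 < k < 1 -> parity s l -> INR l * PI < t < INR (l + 1) * PI ->
  F s k t = 0 <-> reducedF s k t = 0.
Proof.
  intros Hk Hp Ht. pose proof (sgn_sin_pos s l t Hp Ht) as Hs.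
  assert (N : sin t <> 0) by (intros E; rewrite E in Hs; lra).
  rewrite F_eq_reducedF by (assumption || lra). split; intros E.
  - apply Rmult_integral in E as [E | E]; [| exact E].
    apply Rmult_integral in E; lra.
  - rewrite E; ring.
Qed.

(** * Sign of [F] at midpoints and endpoints, and its zeros *)

Lemma sin_mid (l : nat) : sin (mid l) = (-1) ^ l.
Proof. unfold mid. rewrite sin_nat_PI_plus, sin_PI2. ring. Qed.

Lemma cos_mid (l : nat) : cos (mid l) = 0.
Proof. unfold mid. rewrite cos_nat_PI_plus, cos_PI2. ring. Qed.

(** At the midpoint the cosine vanishes and the sine equals [sgn s]. This turns the sign of [F]
    there into the comparison of [k * ellipticE k] with the level [/ (2 * INR l + 1)]. *)
Lemma sgn_F_mid (s : Defs.sign) (l : nat) (k : R) :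
  parity s l -> sgn s * F s k (mid l) = (2 * INR l + 1) * (k * ellipticE k) - 1.
Proof.
  intros Hp. unfold F. rewrite sin_mid, cos_mid, I_mid, <- Hp.
  replace (1 - k ^ 2 * 0 ^ 2) with 1 by ring. rewrite sqrt_1.
  pose proof (sgn_sq s) as Q.
  replace (sgn s * (k * sgn s * ((2 * INR l + 1) * ellipticE k)
    - sgn s * ((1 - sgn s * (k * 0)) * 1)))
    with ((sgn s * sgn s) * ((2 * INR l + 1) * (k * ellipticE k) - 1)) by ring.
  rewrite Q. ring.
Qed.

Lemma reducedF_mid (s : Defs.sign) (l : nat) (k : R) :
  0 < k -> parity s l ->
  k * reducedF s k (mid l) = (2 * INR l + 1) * (k * ellipticE k) - 1.
Proof.
  intros Hk Hp. pose proof (sgn_sq s) as Q.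
  rewrite <- (sgn_F_mid s l k Hp), F_eq_reducedF, sin_mid, <- Hp; [| assumption |].
  - replace (sgn s * (k * sgn s * reducedF s k (mid l)))
      with ((sgn s * sgn s) * (k * reducedF s k (mid l))) by ring.
    rewrite Q; ring.
  - rewrite sin_mid, <- Hp. destruct s; simpl; lra.
Qed.

(** The factor [e] will be [sgn s] left of the midpoint and [- sgn s] right of it, since
    [IVT_interv] expects a passage from negative to positive. *)
Lemma continuity_pt_sgn_F (s : Defs.sign) (e k t : R) :
  0 < k < 1 -> continuity_pt (fun t => e * F s k t) t.
Proof.
  intros Hk. pose proof (radicand_cos_pos k t ltac:(lra)).
  apply derivable_continuous_pt, ex_derive_Reals_0. unfold F.
  auto_derive. repeat split.
  - eexists. apply is_derive_I.
  - assumption.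
Qed.

(** The denominator of [reducedF] vanishes at multiples of [PI], so the sign at the ends of an
    interval is taken from [F], whose integral term drops out there. *)
Lemma sgn_F_neg_at_sin_0 (s : Defs.sign) (k t : R) :
  0 < k < 1 -> sin t = 0 -> sgn s * F s k t < 0.
Proof.
  intros Hk Hs. unfold F. rewrite Hs.
  pose proof (sqrt_lt_R0 _ (radicand_cos_pos k t ltac:(lra))).
  pose proof (sgn_cos_factor_pos s k t Hk).
  replace (sgn s * (k * 0 * I k t - sgn s * ((1 - sgn s * (k * cos t)) * sqrt (1 - k ^ 2 * cos t ^ 2))))
    with (- ((sgn s * sgn s) * ((1 - sgn s * (k * cos t)) * sqrt (1 - k ^ 2 * cos t ^ 2)))) by ring.
  rewrite sgn_sq. nra.
Qed.

Lemma sin_nat_PI (l : nat) : sin (INR l * PI) = 0.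
Proof. rewrite <- (Rplus_0_r (INR l * PI)), sin_nat_PI_plus, sin_0. ring. Qed.

(** Existence comes from [sgn s * F s k], negative at both ends and positive at the midpoint;
    uniqueness in each half comes from strict monotonicity of [reducedF], which has the same zeros
    inside. *)
Lemma F_zeros_exist_unique (s : Defs.sign) (l : nat) (k : R) :
  0 < k < 1 -> parity s l -> 1 < (2 * INR l + 1) * (k * ellipticE k) ->
  (exists! t, zero_left s l k t) /\ (exists! t, zero_right s l k t).
Proof.
  intros Hk Hp Hm. pose proof (mid_bounds l) as Hb. pose proof (sgn_F_mid s l k Hp) as Em.
  assert (Z : forall t, sgn s * F s k t = 0 -> F s k t = 0)
    by (intros t; destruct s; simpl; lra).
  assert (inj : forall x y, INR l * PI < x < INR (l + 1) * PI ->
     INR l * PI < y < INR (l + 1) * PI -> F s k x = 0 -> F s k y = 0 ->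
     reducedF s k x = reducedF s k y).
  { intros x y Hx Hy Ex Ey.
    apply (F_zero_iff s l) in Ex; try assumption.
    apply (F_zero_iff s l) in Ey; try assumption. lra. }
  split.
  - destruct (IVT_interv (fun t => sgn s * F s k t) (INR l * PI) (mid l)) as [t [Ht Et]].
    + intros t _. apply continuity_pt_sgn_F, Hk.
    + lra.
    + apply sgn_F_neg_at_sin_0; [assumption | apply sin_nat_PI].
    + lra.
    + pose proof (sgn_F_neg_at_sin_0 s k (INR l * PI) Hk (sin_nat_PI l)) as E0.
      assert (Ht' : INR l * PI < t < mid l).
      { split.
        - destruct (Req_dec t (INR l * PI)) as [-> |]; lra.
        - destruct (Req_dec t (mid l)) as [-> |]; lra. }
      exists t. split; [split; auto |].
      intros u [Hu Eu]. pose proof (inj t u ltac:(lra) ltac:(lra) (Z t Et) Eu).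
      destruct (Rtotal_order t u) as [L | [L | L]]; [| exact L |].
      * pose proof (reducedF_incr s l k t u Hk Hp ltac:(lra) L ltac:(lra)). lra.
      * pose proof (reducedF_incr s l k u t Hk Hp ltac:(lra) L ltac:(lra)). lra.
  - destruct (IVT_interv (fun t => - sgn s * F s k t) (mid l) (INR (l + 1) * PI)) as [t [Ht Et]].
    + intros t _. apply continuity_pt_sgn_F, Hk.
    + lra.
    + lra.
    + pose proof (sgn_F_neg_at_sin_0 s k _ Hk (sin_nat_PI (l + 1))). lra.
    + pose proof (sgn_F_neg_at_sin_0 s k _ Hk (sin_nat_PI (l + 1))) as E0.
      assert (Ht' : mid l < t < INR (l + 1) * PI).
      { split.
        - destruct (Req_dec t (mid l)) as [-> |]; lra.
        - destruct (Req_dec t (INR (l + 1) * PI)) as [-> |]; lra. }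
      assert (Et' : F s k t = 0) by (apply Z; lra).
      exists t. split; [split; auto |].
      intros u [Hu Eu]. pose proof (inj t u ltac:(lra) ltac:(lra) Et' Eu).
      destruct (Rtotal_order t u) as [L | [L | L]]; [| exact L |].
      * pose proof (reducedF_decr s l k t u Hk Hp ltac:(lra) L ltac:(lra)). lra.
      * pose proof (reducedF_decr s l k u t Hk Hp ltac:(lra) L ltac:(lra)). lra.
Qed.

Lemma parity_upper_iff (l : nat) : parity upper l <-> Nat.Even l.
Proof.
  unfold parity; simpl. destruct (Nat.Even_or_Odd l) as [[m ->] | [m ->]].
  - rewrite pow_1_even. split; [intros _; exists m; reflexivity | reflexivity].
  - rewrite Nat.add_1_r, pow_1_odd. split; [intros; lra |].
    intros [n Hn]. lia.
Qed.

Lemma parity_lower_iff (l : nat) : parity lower l <-> Nat.Odd l.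
Proof.
  unfold parity; simpl. destruct (Nat.Even_or_Odd l) as [[m ->] | [m ->]].
  - rewrite pow_1_even. split; [intros; lra |]. intros [n Hn]. lia.
  - replace ((-1) ^ (2 * m + 1)) with (-1) by (rewrite Nat.add_1_r, pow_1_odd; reflexivity).
    split; [intros _; exists m; reflexivity | reflexivity].
Qed.

(** The index [l] is the integer part of [t / PI]; the sign of the sine rules out that [t] is a
    multiple of [PI] and forces the parity of [l]. *)
Lemma F_zero_location (s : Defs.sign) (k t : R) :
  0 < k < 1 -> 0 < t -> 0 < sgn s * sin t -> F s k t = 0 ->
  exists l, parity s l /\
    ((t = mid l /\ (2 * INR l + 1) * (k * ellipticE k) = 1) \/
     (1 < (2 * INR l + 1) * (k * ellipticE k) /\
       (zero_left s l k t \/ zero_right s l k t))).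
Proof.
  intros Hk Ht Hs EF. pose proof PI_RGT_0 as HPI.
  destruct (nfloor_ex (t / PI)) as [l Hl]; [apply Rlt_le, Rdiv_lt_0_compat; lra |].
  assert (Et : t / PI * PI = t) by (field; lra).
  assert (Hl1 : INR l * PI <= t) by (rewrite <- Et; apply Rmult_le_compat_r; lra).
  assert (Hl2 : t < INR (l + 1) * PI)
    by (rewrite plus_INR, <- Et; apply Rmult_lt_compat_r; simpl; lra).
  assert (Hl3 : INR l * PI < t).
  { destruct (Req_dec t (INR l * PI)) as [E |]; [| lra].
    rewrite E, sin_nat_PI in Hs. lra. }
  assert (Hp : parity s l).
  { pose proof Hl2 as B. rewrite plus_INR in B. simpl (INR 1) in B.
    assert (0 < sin (t - INR l * PI)) by (apply sin_gt_0; lra).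
    replace t with (INR l * PI + (t - INR l * PI)) in Hs by ring.
    rewrite sin_nat_PI_plus in Hs. unfold parity.
    destruct (Nat.Even_or_Odd l) as [P | P];
      [apply parity_upper_iff in P | apply parity_lower_iff in P];
      unfold parity in P; rewrite <- P in *; destruct s; simpl in *; lra. }
  exists l. split; [exact Hp |].
  pose proof (proj1 (F_zero_iff s l k t Hk Hp ltac:(lra)) EF) as EH.
  pose proof (reducedF_mid s l k ltac:(lra) Hp) as Em.
  (* From a zero on either side, [reducedF] rises strictly towards the midpoint, so its value there
     is positive; if the zero is the midpoint itself, that value is 0. *)
  destruct (Rtotal_order t (mid l)) as [L | [L | L]].
  - right. pose proof (reducedF_incr s l k t (mid l) Hk Hp Hl3 L ltac:(lra)).
    split; [nra | left; split; [lra | exact EF]].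
  - left. split; [exact L |]. rewrite <- L, EH in Em. lra.
  - right. pose proof (reducedF_decr s l k (mid l) t Hk Hp ltac:(lra) L ltac:(lra)).
    split; [nra | right; split; [lra | exact EF]].
Qed.

(** * Undularies meeting the unit circle *)

Lemma und_c_eq (a k : R) : 0 < a -> 0 < k < 1 -> und_c a k = a * k.
Proof.
  intros Ha Hk. unfold und_c, und_b.
  rewrite Rpow_mult_distr, <- Rsqr_pow2, <- (Rsqr_pow2 (sqrt _)), Rsqr_sqrt by nra.
  replace (Rsqr a - Rsqr a * (1 - k ^ 2)) with ((a * k) ^ 2) by (unfold Rsqr; ring).
  apply sqrt_pow2. nra.
Qed.

Lemma sqrt_scale (a k x : R) :
  0 < a -> sqrt (a ^ 2 - (a * k) ^ 2 * cos x ^ 2) = a * sqrt (1 - k ^ 2 * cos x ^ 2).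
Proof.
  intros Ha.
  replace (a ^ 2 - (a * k) ^ 2 * cos x ^ 2) with (a ^ 2 * (1 - k ^ 2 * cos x ^ 2)) by ring.
  rewrite sqrt_mult_alt by apply pow2_ge_0. rewrite sqrt_pow2 by lra. reflexivity.
Qed.

(** Isolates the ratio that also governs [und_f], so that one derivative serves both coordinates. *)
Lemma und_g_eq (s : Defs.sign) (a k t : R) :
  0 < a -> 0 < k < 1 ->
  und_g s a k t =
  a * (I k t - k * (sgn s * sin t)
       * ((1 - sgn s * (k * cos t)) / sqrt (1 - k ^ 2 * cos t ^ 2))).
Proof.
  intros Ha Hk. pose proof (sqrt_lt_R0 _ (radicand_cos_pos k t ltac:(lra))).
  unfold und_g, I. rewrite und_c_eq, sqrt_scale by assumption.
  rewrite (RInt_ext _ (fun x => scal a (sqrt (1 - k ^ 2 * cos x ^ 2)))).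
  - rewrite (@RInt_scal R_CompleteNormedModule) by apply ex_RInt_sqrt_cos.
    match goal with |- context [scal a ?J] => change (scal a J) with (a * J) end.
    field. lra.
  - intros x _. apply sqrt_scale, Ha.
Qed.

Lemma und_f_eq (s : Defs.sign) (a k t : R) :
  0 < a -> 0 < k < 1 ->
  und_f s a k t =
  a * sqrt (1 - k ^ 2) * ((1 - sgn s * (k * cos t)) / sqrt (1 - k ^ 2 * cos t ^ 2)).
Proof.
  intros Ha Hk. pose proof (sqrt_lt_R0 _ (radicand_cos_pos k t ltac:(lra))).
  unfold und_f. rewrite und_c_eq, sqrt_scale by assumption. unfold und_b. field. lra.
Qed.

(** With [q = sgn s * (k * cos t)] the radicand is [(1 - q) * (1 + q)], so the ratio is the square
    root of [(1 - q) / (1 + q)]; this is why only [1 + q] and one root remain in the denominator. *)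
Lemma is_derive_und_ratio (s : Defs.sign) (k t : R) :
  0 < k < 1 ->
  is_derive (fun t => (1 - sgn s * (k * cos t)) / sqrt (1 - k ^ 2 * cos t ^ 2)) t
    (k * (sgn s * sin t) / ((1 + sgn s * (k * cos t)) * sqrt (1 - k ^ 2 * cos t ^ 2))).
Proof.
  intros Hk. pose proof (radicand_cos_pos k t ltac:(lra)) as Hp.
  pose proof (sqrt_lt_R0 _ Hp) as Hw.
  pose proof (sqrt_sqrt _ (Rlt_le _ _ Hp)) as Ew.
  assert (Hq : 0 < 1 + sgn s * (k * cos t))
    by (pose proof (COS_bound t); destruct s; simpl; nra).
  auto_derive.
  - repeat split; [exact Hp | apply Rgt_not_eq, Hw].
  - replace (1 + - (k * (k * 1) * (cos t * (cos t * 1)))) with (1 - k ^ 2 * cos t ^ 2) by ring.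
    set (w := sqrt (1 - k ^ 2 * cos t ^ 2)) in *.
    set (S := sin t) in *. set (C := cos t) in *.
    clearbody w S C. destruct s; simpl sgn in *.
    + field [Ew]; lra.
    + field [Ew]; lra.
Qed.

(** Orthogonality reduces to the identity [Key]. Its left side is positive and [I k t > 0], which
    forces the sign of the sine; multiplied by [sgn s], the identity says that [F] vanishes. *)
Lemma meets_orthogonally_F_zero (s : Defs.sign) (a k t : R) :
  0 < a -> 0 < k < 1 -> 0 < t -> undulary_meets_orthogonally s a k t ->
  0 < sgn s * sin t /\ F s k t = 0.
Proof.
  intros Ha Hk Ht [_ Horth].
  pose proof (radicand_cos_pos k t ltac:(lra)) as Hp.
  pose proof (sqrt_lt_R0 _ Hp) as Hw.
  pose proof (sqrt_sqrt _ (Rlt_le _ _ Hp)) as Ew.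
  assert (Hk2 : 0 < 1 - k ^ 2) by nra.
  pose proof (sqrt_lt_R0 _ Hk2) as Hb.
  assert (Hq : 0 < 1 + sgn s * (k * cos t))
    by (pose proof (COS_bound t); destruct s; simpl; nra).
  pose proof (sgn_cos_factor_pos s k t Hk) as Hpp.
  pose proof (sin2_cos2 t) as SC. unfold Rsqr in SC.
  assert (HI : 0 < I k t).
  { apply RInt_gt_0; [exact Ht | | intros; apply continuous_sqrt_cos].
    intros x _. apply sqrt_lt_R0, radicand_cos_pos. lra. }
  pose proof (is_derive_und_ratio s k t Hk) as Dr.
  set (r := fun t => (1 - sgn s * (k * cos t)) / sqrt (1 - k ^ 2 * cos t ^ 2)) in *.
  assert (Df : Derive (und_f s a k) t = a * sqrt (1 - k ^ 2) *
     (k * (sgn s * sin t) / ((1 + sgn s * (k * cos t)) * sqrt (1 - k ^ 2 * cos t ^ 2)))).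
  { apply is_derive_unique.
    apply (is_derive_ext (fun t => a * sqrt (1 - k ^ 2) * r t)).
    - intros x. symmetry. apply und_f_eq; assumption.
    - apply (is_derive_scal r). exact Dr. }
  assert (Dg : Derive (und_g s a k) t =
     a * ((1 - k ^ 2) / ((1 + sgn s * (k * cos t)) * sqrt (1 - k ^ 2 * cos t ^ 2)))).
  { apply is_derive_unique.
    apply (is_derive_ext (fun t => a * (I k t - k * (sgn s * sin t) * r t))).
    - intros x. symmetry. apply und_g_eq; assumption.
    - apply (is_derive_scal (fun t => I k t - k * (sgn s * sin t) * r t)).
      pose proof (is_derive_I k t) as DI.
      auto_derive.
      + repeat split; eexists; eassumption.
      + rewrite (is_derive_unique (fun x : R => I k x) _ _ DI), (is_derive_unique (fun x : R => r x) _ _ Dr). unfold r.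
        set (w := sqrt (1 - k ^ 2 * cos t ^ 2)) in *.
        set (S := sin t) in *. set (C := cos t) in *.
        assert (ES : S * S = 1 - C * C) by lra.
        clear - Hw Ew Hq Hpp ES Hk. destruct s; simpl sgn in *.
        * field [Ew ES]; lra.
        * field [Ew ES]; lra. }
  rewrite Df, Dg, und_g_eq, und_f_eq in Horth by assumption.
  set (w := sqrt (1 - k ^ 2 * cos t ^ 2)) in *.
  assert (Key : (1 - sgn s * (k * cos t)) * w = k * (sgn s * sin t) * I k t).
  { set (b := sqrt (1 - k ^ 2)) in *. set (J := I k t) in *.
    set (S := sin t) in *. set (C := cos t) in *.
    assert (ES : S * S = 1 - C * C) by lra.
    (* The orthogonality expression is this positive factor times the difference of the two sides of
       [Key]; the terms with [1 - k ^ 2] and [k ^ 2 * sin t ^ 2] combine to [w ^ 2]. *)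
    assert (Hpos : 0 < a ^ 2 * b / ((1 + sgn s * (k * C)) * w)).
    { apply Rdiv_lt_0_compat; apply Rmult_lt_0_compat; try assumption. nra. }
    apply Rminus_diag_uniq, (Rmult_eq_reg_r (a ^ 2 * b / ((1 + sgn s * (k * C)) * w))); [| lra].
    rewrite Rmult_0_l, <- Horth.
    clear - Hw Ew Hq ES Hk. destruct s; simpl sgn in *.
    - field [Ew ES]; lra.
    - field [Ew ES]; lra. }
  split.
  - assert (0 < k * (sgn s * sin t) * I k t) by (rewrite <- Key; apply Rmult_lt_0_compat; assumption).
    destruct (Rle_or_lt (sgn s * sin t) 0); [| assumption].
    assert (k * I k t > 0) by nra. nra.
  - unfold F. fold w. rewrite Key.
    replace (sgn s * (k * (sgn s * sin t) * I k t))
      with ((sgn s * sgn s) * (k * sin t * I k t)) by ring.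
    rewrite sgn_sq. ring.
Qed.

(** * Threshold moduli and the classification *)

Lemma kE_level_lt_iff (kappa0 c k0 k : R) :
  0 < kappa0 < 1 -> 2 * ellipticE kappa0 = ellipticK kappa0 ->
  1 <= c -> 0 < k0 < kappa0 -> c * (k0 * ellipticE k0) = 1 -> 0 < k < 1 ->
  1 < c * (k * ellipticE k) <-> k0 < k.
Proof.
  intros H0 HEK Hc Hk0 E0 Hk. split; intros L.
  - destruct (Rtotal_order k k0) as [M | [-> | M]]; [| lra | exact M].
    pose proof (kE_incr kappa0 k k0 H0 HEK ltac:(lra) ltac:(lra)). nra.
  (* Monotonicity is available only below [kappa0]; from there on [k * ellipticE k] exceeds 1, and
     [c >= 1] suffices. *)
  - destruct (Rlt_le_dec k kappa0) as [M | M].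
    + pose proof (kE_incr kappa0 k0 k H0 HEK ltac:(lra) ltac:(lra)). nra.
    + pose proof (kE_gt_1 kappa0 k H0 HEK ltac:(lra)). nra.
Qed.

(** Here [k] ranges over all of [(0, 1)], because the modulus of a given undulary comes without the
    bound [kappa0]. *)
Lemma kE_level_unique (kappa0 c k0 k : R) :
  0 < kappa0 < 1 -> 2 * ellipticE kappa0 = ellipticK kappa0 ->
  1 <= c -> 0 < k0 < kappa0 -> c * (k0 * ellipticE k0) = 1 ->
  0 < k < 1 -> c * (k * ellipticE k) = 1 -> k0 = k.
Proof.
  intros H0 HEK Hc Hk0 E0 Hk E.
  destruct (Rtotal_order k0 k) as [M | [-> | M]]; [| reflexivity |].
  - apply (kE_level_lt_iff kappa0 c) in M; try assumption. lra.
  - pose proof (kE_incr kappa0 k k0 H0 HEK ltac:(lra) ltac:(lra)). nra.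
Qed.

Lemma odd_coeff_ge_1 (l : nat) : 1 <= 2 * INR l + 1.
Proof. pose proof (pos_INR l). lra. Qed.

Lemma F_mid_zero_iff (s : Defs.sign) (l : nat) (k : R) :
  parity s l -> F s k (mid l) = 0 <-> (2 * INR l + 1) * (k * ellipticE k) = 1.
Proof.
  intros Hp. pose proof (sgn_F_mid s l k Hp) as E.
  destruct s; simpl in E; split; intros; lra.
Qed.

Theorem theorem4p6 (kappa0 : R) (hkappa0 : 0 < kappa0 < 1)
    (hEK : 2 * ellipticE kappa0 = ellipticK kappa0) :
  exists kl : nat -> R,
    (forall l : nat, Nat.Even l ->
       unique (fun k => 0 < k < kappa0 /\ F upper k (mid l) = 0) (kl l) /\
       (forall k : R, kl l < k < 1 ->
          (exists! t1 : R, zero_left upper l k t1) /\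
          (exists! t2 : R, zero_right upper l k t2))) /\
    (forall l : nat, Nat.Odd l ->
       unique (fun k => 0 < k < kappa0 /\ F lower k (mid l) = 0) (kl l) /\
       (forall k : R, kl l < k < 1 ->
          (exists! t1 : R, zero_left lower l k t1) /\
          (exists! t2 : R, zero_right lower l k t2))) /\
    (forall a k t : R, 0 < a -> 0 < k < 1 -> 0 < t ->
       undulary_meets_orthogonally upper a k t ->
       exists l : nat, Nat.Even l /\
         ((k = kl l /\ t = mid l) \/
          (kl l < k < 1 /\ (zero_left upper l k t \/ zero_right upper l k t)))) /\
    (forall a k t : R, 0 < a -> 0 < k < 1 -> 0 < t ->
       undulary_meets_orthogonally lower a k t ->
       exists l : nat, Nat.Odd l /\
         ((k = kl l /\ t = mid l) \/
          (kl l < k < 1 /\ (zero_left lower l k t \/ zero_right lower l k t)))).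
Proof.
  pose (kl := fun l => proj1_sig
    (kE_level_exists kappa0 (2 * INR l + 1) hkappa0 hEK (odd_coeff_ge_1 l))).
  assert (Hkl : forall l, 0 < kl l < kappa0 /\ (2 * INR l + 1) * (kl l * ellipticE (kl l)) = 1)
    by (intros l; apply (proj2_sig (kE_level_exists kappa0 _ hkappa0 hEK (odd_coeff_ge_1 l)))).
  (* From here on a threshold is known only through its bounds and its level equation [Hkl]. *)
  clearbody kl. exists kl.
  assert (zeros : forall s l, parity s l ->
    unique (fun k => 0 < k < kappa0 /\ F s k (mid l) = 0) (kl l) /\
    (forall k : R, kl l < k < 1 ->
      (exists! t1 : R, zero_left s l k t1) /\ (exists! t2 : R, zero_right s l k t2))).
  { intros s l Hp. destruct (Hkl l) as [Hb He]. pose proof (odd_coeff_ge_1 l) as Hc. split.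
    - split.
      + split; [exact Hb | apply F_mid_zero_iff; assumption].
      + intros k [Hk Ek]. apply F_mid_zero_iff in Ek; [| exact Hp].
        apply (kE_level_unique kappa0 (2 * INR l + 1)); try assumption. lra.
    - intros k Hk. apply F_zeros_exist_unique; [lra | exact Hp |].
      apply (kE_level_lt_iff kappa0 _ (kl l)); try assumption; lra. }
  assert (classify : forall s a k t, 0 < a -> 0 < k < 1 -> 0 < t ->
    undulary_meets_orthogonally s a k t ->
    exists l, parity s l /\
      ((k = kl l /\ t = mid l) \/
       (kl l < k < 1 /\ (zero_left s l k t \/ zero_right s l k t)))).
  { intros s a k t Ha Hk Ht M.
    apply meets_orthogonally_F_zero in M as [Hs EF]; try assumption.
    destruct (F_zero_location s k t Hk Ht Hs EF) as [l [Hp C]].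
    exists l. split; [exact Hp |].
    destruct (Hkl l) as [Hb He]. pose proof (odd_coeff_ge_1 l) as Hc.
    destruct C as [[Et Ek] | [Hgt Z]].
    - left. split; [| exact Et]. symmetry.
      apply (kE_level_unique kappa0 (2 * INR l + 1)); assumption.
    - right. split; [| exact Z]. split; [| lra].
      apply (kE_level_lt_iff kappa0 (2 * INR l + 1) (kl l) k); assumption. }
  split; [| split; [| split]].
  - intros l Hl. apply zeros, parity_upper_iff, Hl.
  - intros l Hl. apply zeros, parity_lower_iff, Hl.
  - intros a k t Ha Hk Ht M. destruct (classify _ _ _ _ Ha Hk Ht M) as [l [Hp C]].
    exists l. split; [apply parity_upper_iff, Hp | exact C].
  - intros a k t Ha Hk Ht M. destruct (classify _ _ _ _ Ha Hk Ht M) as [l [Hp C]].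
    exists l. split; [apply parity_lower_iff, Hp | exact C].
Qed.
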